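(* Let $X\subset\mathbb{R}^2$ be an open set and let $f:X\to\mathbb{R}$ be locally Lipschitz continuous. If $f$ is directionally differentiable at some $x\in X$, then $\Delta^{\oplus}f(x)\in\partial f(x)$. Moreover, if $f$ is L-smooth at $x\in X$, then $\Delta^{\oplus}f(x)\in\operatorname{cl}\,\operatorname{conv}\,\partial_{L}f(x)\subset\partial f(x)$.
   Context: $\langle\cdot,\cdot\rangle$ is the Euclidean inner product; $e_{(i)}$ is the $i$-th unit coordinate vector; $\operatorname{conv}$ and $\operatorname{cl}$ denote convex hull and closure. Directional derivative: for $X\subset\mathbb{R}^n$ open and $f:X\to\mathbb{R}$, $f'(x;d):=\lim_{t\downarrow 0}\frac{f(x+td)-f(x)}{t}$ (one-sided), if this limit exists. $f$ is directionally differentiable at $x$ if $f'(x;d)$ exists in $\mathbb{R}$ for every $d\in\mathbb{R}^n$. Compass difference: if $f$ is directionally differentiable at $x\in X\subset\mathbb{R}^n$, the compass difference of $f$ at $x$ is the vector $\Delta^{\oplus}f(x)\in\mathbb{R}^n$ whose $i$-th component is $\frac12\left(f'(x;e_{(i)})-f'(x;-e_{(i)})\right)$, $i=1,\dots,n$. Clarke's generalized gradient: for $f:X\to\mathbb{R}$ locally Lipschitz continuous on an open set $X\subset\mathbb{R}^n$, $f^\circ(x;d):=\limsup_{y\to x,\ t\downarrow 0}\frac{f(y+td)-f(y)}{t}$ and $\partial f(x):=\{s\in\mathbb{R}^n: f^\circ(x;d)\ge\langle s,d\rangle\ \ \forall d\in\mathbb{R}^n\}$. L-smoothness (Nesterov):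 a locally Lipschitz continuous $f:X\to\mathbb{R}$ ($X\subset\mathbb{R}^n$ open) is lexicographically (L-)smooth at $x\in X$ if $f$ is directionally differentiable at $x$ and, with $f^{(0)}:=f'(x;\cdot)$, for any vectors $m_{(1)},\dots,m_{(n)}\in\mathbb{R}^n$ the inductive sequence of higher-order directional derivatives $f^{(k)}:=[f^{(k-1)}]'(m_{(k)};\cdot)$, $k=1,\dots,n$, is well-defined. If the $m_{(i)}$ are linearly independent, then $f^{(n)}$ is linear, and its constant gradient is called a lexicographic subgradient of $f$ at $x$. The lexicographic subdifferential $\partial_{L}f(x)$ is the set of all lexicographic subgradients of $f$ at $x$ (over all linearly independent choices of $m_{(1)},\dots,m_{(n)}$). *)

(* Defs.v *)
From HB Require Import structures.
From mathcomp Require Import all_boot all_order all_algebra.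
From mathcomp Require Import all_classical all_reals all_analysis.

Set Implicit Arguments.
Unset Strict Implicit.
Unset Printing Implicit Defensive.

Import Order.TTheory GRing.Theory Num.Theory.
Import numFieldNormedType.Exports.

Local Open Scope classical_set_scope.
Local Open Scope ring_scope.

Section nonsmooth.
Context {R : realType} {n : nat}.
Implicit Types (f : 'rV[R]_n -> R) (x d s : 'rV[R]_n).

(* A function on an open set X is represented by a total function on R^n: the
   notions below at a point of X only depend on its values near that point. *)

Definition dotmul s d : R := \sum_(i < n) s 0 i * d 0 i.

Definition diff_quotient f x d (t : R) : R := (f (x + t *: d) - f x) / t.

(* One-sided directional derivative; a meaningful value only when the limit
   exists in R, see [dir_differentiable]. *)
Definition dir_derive f x d : R := lim (diff_quotient f x d t @[t --> 0^'+]).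

Definition dir_differentiable f x : Prop :=
  forall d, cvg (diff_quotient f x d t @[t --> 0^'+]).

Definition compass_difference f x : 'rV[R]_n :=
  \row_(i < n)
    (2^-1 * (dir_derive f x (delta_mx 0 i) - dir_derive f x (- delta_mx 0 i))).

(* The joint limsup as y --> x and t --> 0 with t > 0; y = x is allowed. *)
Definition clarke_derive f x d : \bar R :=
  limf_esup (fun yt : 'rV[R]_n * R => (diff_quotient f yt.1 d yt.2)%:E)
    (filter_prod (nbhs x) 0^'+).

Definition clarke_gradient f x : set 'rV[R]_n :=
  [set s | forall d, ((dotmul s d)%:E <= clarke_derive f x d)%E].

(* The k-th function f^(k), directions being counted from 0: f^(0) = f'(x; .)
   and f^(k+1) = [f^(k)]'(m`_k; .). *)
Fixpoint lex_derive f x (m : seq 'rV[R]_n) (k : nat) : 'rV[R]_n -> R :=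
  if k is j.+1 then dir_derive (lex_derive f x m j) m`_j else dir_derive f x.

Definition L_smooth f x : Prop :=
  dir_differentiable f x /\
  forall m : n.-tuple 'rV[R]_n, forall k, (k < n)%N ->
    dir_differentiable (lex_derive f x m k) m`_k.

(* Meaningful for f L-smooth at x. The gradient of the linear function f^(n) is
   the vector that represents it through the inner product. *)
Definition lex_subdifferential f x : set 'rV[R]_n :=
  [set s | exists2 m : n.-tuple 'rV[R]_n,
    free m & forall d, lex_derive f x m n d = dotmul s d].

Definition convex_hull (A : set 'rV[R]_n) : set 'rV[R]_n :=
  smallest (@convex_set R 'rV[R]_n) A.

End nonsmooth.

(* Main.v *)
Require Import Defs.
From HB Require Import structures.
From mathcomp Require Import all_boot all_order all_algebra.
From mathcomp Require Import all_classical all_reals all_analysis.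
From mathcomp Require Import ring lra.

Set Implicit Arguments.
Unset Strict Implicit.
Unset Printing Implicit Defensive.

Import Order.TTheory GRing.Theory Num.Theory.
Import numFieldNormedType.Exports.

Local Open Scope classical_set_scope.
Local Open Scope ring_scope.

(* Let g = f'(x; .), which is positively homogeneous. Every difference quotient
   of g in the direction d is a limit of difference quotients of f near x, hence
   at most f°(x; d). For d = (a, b), homogeneity writes <compass, d> as the
   average of g(a, 0) - g(0, -b) and g(0, b) - g(-a, 0), two increments of g along
   d; this gives the first claim.
   Bounds on difference quotients survive directional differentiation, so
   lexicographic subgradients lie in the closed convex Clarke gradient. If the
   compass difference were not in the closed convex hull of the lexicographic
   subdifferential, some d and c would separate them: <s, d> <= c < <compass, d>
   for all lexicographic subgradients s. For w independent of d, g'(w; d) is such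
   a value <s, d>; by the mean value inequality along lines avoiding the origin,
   and by continuity of g for the others, all increments of g along d are at most
   c, and then so is <compass, d>. *)

(** * Limits from the right at zero *)

Lemma cvg_at_right0 (R : realType) (T : Type) (F : set_system T) {FF : Filter F}
    (h : T -> R) :
  h y @[y --> F] --> 0 -> (\forall y \near F, 0 < h y) ->
  h y @[y --> F] --> 0^'+.
Proof.
by move=> h0 hgt0 A /h0; apply: filterS2 hgt0 => y y0; exact.
Qed.

Lemma scale_cvg_at_right0 (R : realType) (c : R) :
  0 < c -> (t * c) @[t --> 0^'+] --> 0^'+.
Proof.
move=> c0; apply: cvg_at_right0; last first.
  by near=> t; rewrite mulr_gt0//; near: t; exact: nbhs_right_gt.
have : t * c @[t --> 0^'+] --> 0 * c by apply: cvgMr_tmp; exact: cvg_within.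
by rewrite mul0r.
Unshelve. all: by end_near. Qed.

Lemma cvg_ray (R : realType) (n : nat) (x v : 'rV[R]_n) :
  x + t *: v @[t --> 0^'+] --> x.
Proof.
have : x + t *: v @[t --> 0^'+] --> x + 0 *: v.
  by apply: cvgD; [exact: cvg_cst|apply: cvgZr_tmp; exact: cvg_within].
by rewrite scale0r addr0.
Qed.

(** The bound [e] is extended because Clarke derivatives will serve as bounds; properness of [F]
    excludes [-oo]. *)
Lemma cvg_le_EFin (R : realType) (T : Type) (F : set_system T)
    {FF : ProperFilter F} (h : T -> R) (l : R) (e : \bar R) :
  h y @[y --> F] --> l -> (\forall y \near F, ((h y)%:E <= e)%E) ->
  (l%:E <= e)%E.
Proof.
move=> hl; case: e => [e||]; last by move=> /filter_ex[].
- move=> he; rewrite lee_fin -(cvg_lim _ hl)//.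
  apply: limr_le; first by apply/cvg_ex; exists l.
  by near=> y; rewrite -lee_fin; near: y.
- by rewrite leey.
Unshelve. all: by end_near. Qed.

(** * Directional derivatives and positive homogeneity *)

Section positively_homogeneous.
Context {R : realType} {n : nat}.
Implicit Types (f h : 'rV[R]_n -> R) (x d u v m : 'rV[R]_n).

Definition poshom h := forall c d, 0 < c -> h (c *: d) = c * h d.

Lemma poshom0 h : poshom h -> h 0 = 0.
Proof. by move=> /(_ 2 0 (ltr0Sn _ _)); rewrite scaler0 => ?; lra. Qed.

Lemma dir_derive_eq f x d (l : R) :
  diff_quotient f x d t @[t --> 0^'+] --> l -> dir_derive f x d = l.
Proof. exact: cvg_lim. Qed.

Lemma dir_derive_poshom f x : dir_differentiable f x -> poshom (dir_derive f x).
Proof.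
move=> df c d c0; apply: dir_derive_eq.
have cf : diff_quotient f x d (t * c) @[t --> 0^'+] --> dir_derive f x d.
  exact: (cvg_comp _ _ (scale_cvg_at_right0 c0) (df d)).
apply: cvg_trans (cvgMl_tmp (a := c) cf); apply: near_eq_cvg.
near=> t; have t0 : 0 < t by near: t; exact: nbhs_right_gt.
rewrite /diff_quotient scalerA; field.
by rewrite !gt_eqF.
Unshelve. all: by end_near. Qed.

(** The quotients of [f] at [x] along [u + c *: d] and along [u] share the term [f x]; their
    difference, divided by [c], is the quotient from the moving base point. *)
Lemma cvg_diff_quotient_dir_derive f x u d (c : R) :
  dir_differentiable f x -> 0 < c ->
  diff_quotient f (x + t *: u) d (t * c) @[t --> 0^'+] -->
    diff_quotient (dir_derive f x) u d c.
Proof.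
move=> df c0.
apply: cvg_trans (cvgMr_tmp (b := c^-1) (cvgB (df (u + c *: d)) (df u))).
apply: near_eq_cvg.
near=> t; have t0 : 0 < t by near: t; exact: nbhs_right_gt.
rewrite !fctE /diff_quotient/= scalerDr addrA scalerA; field.
by rewrite !gt_eqF.
Unshelve. all: by end_near. Qed.

(** Such directions accumulate under lexicographic differentiation until the function is linear. *)
Definition additive_along h v :=
  forall u (a : R), h (u + a *: v) = h u + a * h v.

(** The point [m + s *: (u + a *: m)] is [1 + s * a] times a point [m + s' *: u]. By homogeneity the
    quotient along [u + a *: m] is the one along [u] with step [s'], plus [a * h m]. *)
Lemma dir_derive_additive_self h m : poshom h -> dir_differentiable h m ->
  dir_derive h m m = h m /\ additive_along (dir_derive h m) m.
Proof.
move=> hh dh.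
have H u a : dir_derive h m (u + a *: m) = dir_derive h m u + a * h m.
  apply: dir_derive_eq.
  have sa : (1 + s * a) @[s --> 0^'+] --> (1 : R).
    have : (1 + s * a) @[s --> 0^'+] --> 1 + 0 * a.
      by apply: cvgD; [exact: cvg_cst|apply: cvgMr_tmp; exact: cvg_within].
    by rewrite mul0r addr0.
  have sa0 : \forall s \near 0^'+, 0 < 1 + s * a.
    exact: (cvgr_gt _ sa).
  have cu : diff_quotient h m u (s / (1 + s * a)) @[s --> 0^'+] -->
      dir_derive h m u.
    apply: cvg_comp (dh u); apply: cvg_at_right0.
      have : s / (1 + s * a) @[s --> 0^'+] --> 0 / (1 : R).
        by apply: cvgM; [exact: cvg_within|apply: cvgV].
      by rewrite mul0r.
    near=> s; apply: divr_gt0; near: s => //; exact: nbhs_right_gt.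
  apply: cvg_trans (cvgD cu (cvg_cst (a * h m))); apply: near_eq_cvg.
  near=> s; have s0 : 0 < s by near: s; exact: nbhs_right_gt.
  have s1 : 0 < 1 + s * a by near: s.
  rewrite !fctE/= /diff_quotient.
  have -> : m + s *: (u + a *: m) =
      (1 + s * a) *: (m + (s / (1 + s * a)) *: u).
    rewrite [RHS]scalerDr [in RHS]scalerA [_ * (s / _)]mulrC divfK ?gt_eqF//.
    by rewrite scalerDl scale1r scalerDr scalerA addrA addrAC.
  by rewrite hh//; field; rewrite !gt_eqF.
have hm : dir_derive h m m = h m.
  have := H 0 1; rewrite add0r scale1r mul1r.
  by rewrite (poshom0 (dir_derive_poshom dh)) add0r.
by split=> // u a; rewrite hm.
Unshelve. all: by end_near. Qed.

(** Each difference quotient of [h] at [m] splits off [a * h v] exactly, so additivity passes to the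
    limit. *)
Lemma dir_derive_additive h m v : dir_differentiable h m ->
  additive_along h v ->
  dir_derive h m v = h v /\ additive_along (dir_derive h m) v.
Proof.
move=> dh hv.
have H u a : dir_derive h m (u + a *: v) = dir_derive h m u + a * h v.
  apply: dir_derive_eq.
  apply: cvg_trans (cvgD (dh u) (cvg_cst (a * h v))); apply: near_eq_cvg.
  near=> s; have s0 : 0 < s by near: s; exact: nbhs_right_gt.
  rewrite !fctE/= /diff_quotient scalerDr addrA scalerA hv; field.
  by rewrite !gt_eqF.
have hm : dir_derive h m v = h v.
  have := H 0 1; rewrite add0r scale1r mul1r.
  by rewrite (poshom0 (dir_derive_poshom dh)) add0r.
by split=> // u a; rewrite hm.
Unshelve. all: by end_near. Qed.

End positively_homogeneous.

(** * Inner product, convexity and separation *)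

Section inner_product.
Context {R : realType} {n : nat}.
Implicit Types (s d u v p : 'rV[R]_n) (K : set 'rV[R]_n).

Lemma dotmulC u v : dotmul u v = dotmul v u.
Proof. by apply: eq_bigr => i _; rewrite mulrC. Qed.

Lemma dotmulDl u v d : dotmul (u + v) d = dotmul u d + dotmul v d.
Proof. by rewrite -big_split; apply: eq_bigr => i _; rewrite mxE mulrDl. Qed.

Lemma dotmulZl a u d : dotmul (a *: u) d = a * dotmul u d.
Proof. by rewrite mulr_sumr; apply: eq_bigr => i _; rewrite mxE mulrA. Qed.

Lemma dotmulDr d u v : dotmul d (u + v) = dotmul d u + dotmul d v.
Proof. by rewrite dotmulC dotmulDl !(dotmulC d). Qed.

Lemma dotmulZr a d u : dotmul d (a *: u) = a * dotmul d u.
Proof. by rewrite dotmulC dotmulZl dotmulC. Qed.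

Lemma dotmulBl u v d : dotmul (u - v) d = dotmul u d - dotmul v d.
Proof. by rewrite -scaleN1r dotmulDl dotmulZl mulN1r. Qed.

Lemma dotmul0r d : dotmul d 0 = 0.
Proof. by rewrite -(scale0r 0) dotmulZr mul0r. Qed.

Lemma dotmul_ge0 u : 0 <= dotmul u u.
Proof. by apply: sumr_ge0 => i _; rewrite -expr2 sqr_ge0. Qed.

(** The norm is the max norm: its square is one of the summands on the right. *)
Lemma normr_sqr_le_dotmul u : `|u| ^+ 2 <= dotmul u u.
Proof.
have [->|u0] := eqVneq `|u| 0; first by rewrite expr0n dotmul_ge0.
have /mx_norm_neq0[[i j] /= E] : mx_norm u != 0 by [].
have -> : `|u| = `|u i j| by [].
rewrite real_normK ?num_real// (ord1 i) /dotmul (bigD1 j)//= -expr2 lerDl.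
by apply: sumr_ge0 => k _; rewrite -expr2 sqr_ge0.
Qed.

Lemma dotmul_eq0 u : dotmul u u = 0 -> u = 0.
Proof.
move=> u0; apply/eqP; rewrite -normr_eq0 -sqrf_eq0 eq_le sqr_ge0 andbT.
by rewrite -u0 normr_sqr_le_dotmul.
Qed.

Lemma continuous_dotmul (T : topologicalType) (f g : T -> 'rV[R]_n) :
  continuous f -> continuous g -> continuous (fun x => dotmul (f x) (g x)).
Proof.
move=> cf cg; apply: continuous_big => [|i _]; first exact: add_continuous.
move=> x; apply: cvgM.
  by apply: (cvg_comp f (fun v => v 0 i) (cf x)); exact: coord_continuous.
by apply: (cvg_comp g (fun v => v 0 i) (cg x)); exact: coord_continuous.
Qed.

Lemma convex_setP K : convex_set K <->
  forall u v (a : R), 0 <= a <= 1 -> K u -> K v -> K (a *: u + (1 - a) *: v).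
Proof.
split=> [cK u v a /andP[a0 a1] Ku Kv|cK u v a /[!inE] Ku Kv].
  have := cK u v (Itv01 a0 a1); rewrite !inE; exact.
by apply: cK => //; apply/andP.
Qed.

Lemma convex_closure K : convex_set K -> convex_set (closure K).
Proof.
move=> /convex_setP cK; apply/convex_setP => u v a a01 Ku Kv.
(* Affine maps are continuous, so one endpoint at a time can be moved from [K] to its closure. *)
have affineP (w : 'rV[R]_n) (b : R) :
    (forall z, K z -> closure K (b *: z + w)) ->
    forall z, closure K z -> closure K (b *: z + w).
  move=> Kw; rewrite -/(closure K `<=` (fun z => b *: z + w) @^-1` closure K).
  rewrite [X in X `<=` _]closureE; apply: smallest_sub => //.
  apply: preimage_closed; last exact: closed_closure.
  move=> z _; apply: continuousD; last exact: cst_continuous.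
  exact: scaler_continuous.
rewrite addrC; apply: (affineP _ _ _ _ Kv) => z Kz.
rewrite addrC; apply: (affineP _ _ _ _ Ku) => w Kw.
by apply: subset_closure; exact: cK.
Qed.

(* The separating direction points from the Euclidean projection of [p] on [K]
   to [p]. *)
Lemma closed_convex_separation K p : closed K -> convex_set K -> K !=set0 ->
  ~ K p -> exists d, exists2 c, c < dotmul p d & forall s, K s -> dotmul s d <= c.
Proof.
move=> Kclosed /convex_setP Kconv [s0 Ks0] Kp.
pose phi s := dotmul (s - p) (s - p).
have cphi : continuous phi.
  suff cp : continuous (fun s => s - p) by exact: continuous_dotmul.
  by move=> s; apply: continuousB; [exact: cvg_id|exact: cst_continuous].
(* Cutting [K] down to a sublevel set gives compactness without changing the minimum of [phi]. *)
pose A := K `&` [set s | phi s <= phi s0].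
have cptA : compact A.
  apply: bounded_closed_compact.
    exists (`|p| + (1 + phi s0)); split=> [|M /ltW CM s [_ /= ss0]].
      exact: num_real.
    apply: le_trans CM.
    rewrite -[X in `|X|](subrK p) addrC (le_trans (ler_normD _ _))// lerD2l.
    have := normr_sqr_le_dotmul (s - p); rewrite -/(phi s) => H.
    by have := normr_ge0 (s - p); nra.
  apply: closedI => //.
  by apply: (preimage_closed (D := [set x | x <= phi s0])) => [x _|//]; exact: cphi.
have A0 : A !=set0 by exists s0; split => /=.
have [q + qmin] := EVT_min_rV A0 cptA (continuous_subspaceT cphi).
rewrite inE => /= -[Kq qs0].
have {}qmin s : K s -> phi q <= phi s.
  move=> Ks; have [ss0|/ltW] := leP (phi s) (phi s0).
    by apply: qmin; rewrite inE.
  exact: le_trans.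
exists (p - q), (dotmul q (p - q)).
  rewrite -subr_gt0 -dotmulBl lt_neqAle dotmul_ge0 andbT eq_sym.
  by apply/eqP => /dotmul_eq0/eqP; rewrite subr_eq0 => /eqP pq; rewrite pq in Kp.
move=> s Ks; rewrite -subr_le0 -dotmulBl leNgt; apply/negP.
set a := dotmul _ _ => a0; pose b := dotmul (s - q) (s - q).
have b0 : 0 <= b by exact: dotmul_ge0.
have ab0 : 0 < a + b by rewrite ltr_pwDl.
(* Moving from [q] towards [s] by [l] changes [phi] by [- 2 * l * a + l ^+ 2 * b]. This is negative
   since [l * b <= a]; the denominator [a + b] stays positive and keeps [l] at most 1. *)
pose l := a / (a + b).
have l01 : 0 <= l <= 1.
  by rewrite divr_ge0 ?(ltW a0) ?(ltW ab0)//= ler_pdivrMr// mul1r lerDl.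
have l0 : 0 < l by rewrite divr_gt0.
have := qmin _ (Kconv _ _ _ l01 Ks Kq).
have -> : phi (l *: s + (1 - l) *: q) = phi q - 2 * l * a + l ^+ 2 * b.
  rewrite /phi (_ : _ - p = l *: (s - q) + (-1) *: (p - q)); last first.
    by apply/rowP => i; rewrite !mxE; ring.
  have -> : q - p = (-1) *: (p - q) by rewrite scaleN1r opprB.
  rewrite /a /b; move: (s - q) (p - q) => w z.
  by rewrite !(dotmulDl, dotmulDr, dotmulZl, dotmulZr) (dotmulC z w); ring.
have lb : l * b <= a by rewrite /l mulrAC ler_pdivrMr//; nra.
nra.
Qed.

End inner_product.

(** * The Clarke gradient and bounds on slopes *)

Section clarke.
Context {R : realType} {n : nat}.
Implicit Types (f h : 'rV[R]_n -> R) (x d u v : 'rV[R]_n) (e : \bar R).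

Definition slope_le h d e :=
  forall u c, 0 < c -> ((diff_quotient h u d c)%:E <= e)%E.

Lemma slope_le_dir_derive h x d e : dir_differentiable h x ->
  slope_le h d e -> slope_le (dir_derive h x) d e.
Proof.
move=> dh he u c c0.
apply: cvg_le_EFin (cvg_diff_quotient_dir_derive dh c0) _.
near=> t; apply: he; exact: mulr_gt0.
Unshelve. all: by end_near. Qed.

(** The pairs [(x + t *: u, t * c)] eventually enter every neighbourhood in the limsup, because its
    base point may vary. *)
Lemma slope_le_clarke f x d : dir_differentiable f x ->
  slope_le (dir_derive f x) d (clarke_derive f x d).
Proof.
move=> df u c c0; apply/ereal_infP => _ [V FV <-].
apply: cvg_le_EFin (cvg_diff_quotient_dir_derive df c0) _.
have : \forall t \near 0^'+, V (x + t *: u, t * c).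
  exact: (cvg_pair (@cvg_ray _ _ x u) (scale_cvg_at_right0 c0)).
apply: filterS => t Vt; apply: ereal_sup_ubound.
by exists (x + t *: u, t * c).
Qed.

Lemma slope_le_lex_derive f x (m : n.-tuple 'rV[R]_n) k d : L_smooth f x ->
  (k <= n)%N -> slope_le (lex_derive f x m k) d (clarke_derive f x d).
Proof.
move=> [df dlex]; elim: k => [_|k IHk kn]; first exact: slope_le_clarke.
by apply: slope_le_dir_derive; [exact: dlex|exact/IHk/ltnW].
Qed.

Lemma lex_subdifferential_clarke f x : L_smooth f x ->
  lex_subdifferential f x `<=` clarke_gradient f x.
Proof.
move=> fx s [m _ sm] d.
(* For the linear last derivative, the slope from 0 with step 1 is already [dotmul s d]. *)
have := @slope_le_lex_derive f x m n d fx (leqnn n) 0 1 ltr01.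
by rewrite /diff_quotient !sm dotmul0r add0r scale1r subr0 divr1.
Qed.

Lemma clarke_gradient_closed f x : closed (clarke_gradient f x).
Proof.
rewrite (_ : clarke_gradient f x =
  \bigcap_d (dotmul ^~ d @^-1` [set r : R | (r%:E <= clarke_derive f x d)%E])).
  apply: closed_bigI => d _; apply: preimage_closed => [y _|].
    apply: continuous_dotmul; [by move=> z; exact: cvg_id|exact: cst_continuous].
  case: (clarke_derive f x d) => [r||].
  - by under eq_set do rewrite lee_fin; exact: closed_le.
  - rewrite (_ : mkset _ = setT); first exact: closedT.
    by apply/seteqP; split => // r _ /=; exact: leey.
  - by rewrite (_ : mkset _ = set0); [exact: closed0|apply/seteqP; split].
by apply/seteqP; split => s /= sx d; [move=> _|]; exact: sx.
Qed.

Lemma clarke_gradient_convex f x : convex_set (clarke_gradient f x).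
Proof.
apply/convex_setP => u v a /andP[a0 a1] xu xv d.
have := xu d; have := xv d; case: (clarke_derive f x d) => [r||].
- rewrite !lee_fin dotmulDl !dotmulZl; nra.
- by move=> _ _; exact: leey.
- by [].
Qed.

End clarke.

(** * Linearity of the last lexicographic derivative *)

Section lexicographic.
Context {R : realType} {n : nat}.
Implicit Types (f h : 'rV[R]_n -> R) (x d u v : 'rV[R]_n).

Lemma lex_derive_poshom f x (m : n.-tuple 'rV[R]_n) k : L_smooth f x ->
  (k <= n)%N -> poshom (lex_derive f x m k).
Proof.
by move=> [df dlex]; case: k => [_|k kn]; apply: dir_derive_poshom; auto.
Qed.

(** Differentiating at a direction creates additivity along it, and later differentiations preserve
    it. *)
Lemma lex_derive_additive f x (m : n.-tuple 'rV[R]_n) j k : L_smooth f x ->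
  (j < k <= n)%N -> additive_along (lex_derive f x m k) m`_j.
Proof.
move=> fx; have [_ dlex] := fx.
elim: k => [//|k IHk] /andP[]; rewrite ltnS leq_eqVlt => /predU1P[->|jk] kn.
  apply: (dir_derive_additive_self _ (dlex m k kn)).2.
  exact: lex_derive_poshom (ltnW kn).
apply: (dir_derive_additive (dlex m k kn) _).2; apply: IHk.
by rewrite jk ltnW.
Qed.

Lemma additive_alongD h u v :
  additive_along h u -> additive_along h v -> additive_along h (u + v).
Proof.
move=> hu hv w a; rewrite scalerDr addrA hv hu.
by have := hv u 1; rewrite scale1r => ->; ring.
Qed.

Lemma additive_alongZ h v b : additive_along h v -> additive_along h (b *: v).
Proof.
move=> hv w a; rewrite scalerA hv.
have h0 : h 0 = 0 by have := hv 0 1; rewrite scale1r add0r; lra.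
by have := hv 0 b; rewrite add0r h0 => ->; ring.
Qed.

(** A free [m] spans the space, so additivity along its members extends to every vector. *)
Lemma lex_derive_dotmul f x (m : n.-tuple 'rV[R]_n) : L_smooth f x -> free m ->
  exists s, forall d, lex_derive f x m n d = dotmul s d.
Proof.
move=> fx fm; set L := lex_derive f x m n.
have L0 : L 0 = 0 by apply: poshom0; exact: lex_derive_poshom.
have additiveL v : additive_along L v.
  have /coord_span-> : v \in <<m>>%VS.
    suff /span_basis-> : basis_of fullv m by exact: memvf.
    by rewrite basisEfree fm subvf dimvf dim_matrix mul1r size_tuple leqnn.
  apply: (big_ind (additive_along L)) => [u a|u w|i _].
  - by rewrite scaler0 L0 mulr0 !addr0.
  - exact: additive_alongD.
  - apply: additive_alongZ; apply: lex_derive_additive => //.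
    by rewrite ltn_ord leqnn.
exists (\row_i L (delta_mx 0 i)) => d.
have LD u v : L (u + v) = L u + L v.
  by have := additiveL v u 1; rewrite scale1r mul1r.
have LZ a v : L (a *: v) = a * L v.
  by have := additiveL v 0 a; rewrite L0 !add0r.
rewrite [in LHS](row_sum_delta d) (big_morph L LD L0).
by apply: eq_bigr => i _; rewrite LZ mxE mulrC.
Qed.

End lexicographic.

(** * Lipschitz bounds and a mean value inequality *)

Section mean_value.
Context {R : realType} {n : nat}.
Implicit Types (f g : 'rV[R]_n -> R) (x d u v : 'rV[R]_n) (X : set 'rV[R]_n).

Lemma locally_lipschitz_near f X x : open X ->
  [locally [lipschitz f y | y in X]] -> X x ->
  exists M, \forall yz \near (x, x),
    `|f yz.1 - f yz.2| <= M * `|yz.1 - yz.2|.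
Proof.
move=> oX lipf Xx.
have lipx : lipschitz_on f (within (X `*` X) (nbhs (x, x))).
  exact: (lipf (x, x)).
have [M HM] : exists M, M.-lipschitz_on f (within (X `*` X) (nbhs (x, x))).
  by near (pinfty_nbhs R) => M; exists M; near: M.
exists M; have XX : nbhs (x, x) (X `*` X).
  by exists (X, X) => //; split; exact: open_nbhs_nbhs.
have {}HM : nbhs (x, x) [set yz | (X `*` X) yz ->
    `|f yz.1 - f yz.2| <= M * `|yz.1 - yz.2|] by exact: HM.
by apply: filterS2 XX HM => yz XXyz; exact.
Unshelve. all: by end_near. Qed.

Lemma dir_derive_lipschitz f x M : dir_differentiable f x ->
  (\forall yz \near (x, x), `|f yz.1 - f yz.2| <= M * `|yz.1 - yz.2|) ->
  forall u v, `|dir_derive f x u - dir_derive f x v| <= M * `|u - v|.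
Proof.
move=> df fM u v.
apply: (cvgr_to_le (cvg_norm (cvgB (df u) (df v)))).
near=> t; have t0 : 0 < t by [].
have H : `|f (x + t *: u) - f (x + t *: v)| <=
    M * `|(x + t *: u) - (x + t *: v)|.
  by near: t; exact: (cvg_pair (@cvg_ray _ _ x u) (@cvg_ray _ _ x v) fM).
rewrite !fctE /diff_quotient/= -mulrBl.
rewrite opprB addrA subrK normrM normfV (gtr0_norm t0) ler_pdivrMr//.
apply: le_trans H _; rewrite opprD addrACA subrr add0r -scalerBr normrZ.
by rewrite (gtr0_norm t0) mulrAC mulrA.
Unshelve. all: by end_near. Qed.

Lemma lipschitz_continuous g M :
  (forall u v, `|g u - g v| <= M * `|u - v|) -> continuous g.
Proof.
move=> gM x; apply/(cvgrPdist_le (F := nbhs x)) => e e0.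
(* [M] itself may be zero or negative, so it cannot serve as a divisor. *)
have M0 : 0 < `|M| + 1 by rewrite ltr_wpDl.
have := nbhsx_ballx x _ (divr_gt0 e0 M0).
apply: filterS => y; rewrite -ball_normE/= ltr_pdivlMr// => xy.
apply: le_trans (gM x y) _; apply: le_trans (ltW xy).
by rewrite mulrC ler_wpM2l// (le_trans (ler_norm _))// lerDl ler01.
Qed.

(** With slope bound [c + e], the last time [b] in [[0, 1]] at which the bound from time 0 holds
    must be 1: before that, the right derivative lets it hold a little further. *)
Lemma dir_derive_le_increment g u d (c : R) : continuous g ->
  (forall t, 0 <= t < 1 ->
    dir_differentiable g (u + t *: d) /\ dir_derive g (u + t *: d) d <= c) ->
  g (u + d) - g u <= c.
Proof.
move=> cg dg; apply/ler_addgt0Pr => e e0.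
pose phi t := g (u + t *: d) - t * (c + e).
have cphi : continuous phi.
  move=> t; apply: cvgB; last by apply: cvgMr_tmp; exact: cvg_id.
  apply: (cvg_comp (fun t => u + t *: d) g) (cg _).
  by apply: cvgD; [exact: cvg_cst|apply: cvgZr_tmp; exact: cvg_id].
pose A := `[0, 1]%classic `&` [set t | phi t <= phi 0].
have cptA : compact A.
  apply: compact_closedI; first exact: segment_compact.
  apply: (preimage_closed (D := [set r | r <= phi 0])) => [t _|//].
  exact: cphi.
have A0 : A 0 by split => //=; rewrite in_itv/= lexx ler01.
have [b] := compact_EVT_max (ex_intro _ 0 A0) cptA
  (continuous_subspaceT (f := id) (fun=> cvg_id)).
rewrite inE /A/= in_itv/= => -[/andP[b0 b1] phib] bmax.
have [b1'|b1'] := ltP b 1; last first.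
  have eb : b = 1 by apply/eqP; rewrite eq_le b1.
  by move: phib; rewrite eb /phi scale1r scale0r addr0; lra.
have [db dbc] := dg b (introT andP (conj b0 b1')).
have [t [t0 tb tc]] : exists t, [/\ 0 < t, t < 1 - b &
    diff_quotient g (u + b *: d) d t < c + e].
  near (at_right (0 : R)) => t; exists t; split; near: t.
  - exact: nbhs_right_gt.
  - by apply: nbhs_right_lt; rewrite subr_gt0.
  - by apply: (cvgr_lt _ (db d)); rewrite (le_lt_trans dbc)// ltrDl.
suff : A (b + t) by rewrite -in_setE => /bmax; rewrite gerDl leNgt t0.
split => /=; first by rewrite in_itv/=; lra.
apply: le_trans phib; move: tc; rewrite /diff_quotient ltr_pdivrMr// /phi.
by rewrite scalerDl addrA; lra.
Unshelve. all: by end_near. Qed.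

End mean_value.

(** * The compass difference in the plane *)

Section plane.
Context {R : realType}.
Implicit Types (f : 'rV[R]_2 -> R) (x d u v w : 'rV[R]_2).

(* With [d = (a, b)], homogeneity turns <compass, d> into the average of the
   increments of [f'(x; .)] along [d] from [(0, -b)] and from [(-a, 0)]. *)
Lemma compass_difference_le f x d (e : \bar R) : dir_differentiable f x ->
  (forall u, ((dir_derive f x (u + d) - dir_derive f x u)%:E <= e)%E) ->
  ((dotmul (compass_difference f x) d)%:E <= e)%E.
Proof.
move=> df; have := dir_derive_poshom df; set g := dir_derive f x => hg He.
pose E i : 'rV[R]_2 := delta_mx 0 i.
(* Homogeneity covers positive scalars only; for [a < 0] the two opposite unit vectors exchange
   roles. *)
have gE i (a : R) : a * (g (E i) - g (- E i)) = g (a *: E i) - g (- (a *: E i)).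
  have [a0|a0|->] := ltgtP a 0.
  - have := hg (- a) (E i); have := hg (- a) (- E i).
    rewrite oppr_gt0 scaleNr scalerN opprK scaleNr => /(_ a0) -> /(_ a0) ->.
    ring.
  - by rewrite -scalerN !hg//; ring.
  - by rewrite mul0r scale0r oppr0 subrr.
have dE : d = d 0 0 *: E 0 + d 0 1 *: E 1.
  rewrite [LHS]row_sum_delta big_ord_recl big_ord1.
  by rewrite (_ : lift ord0 ord0 = 1) //; exact: val_inj.
set p := d 0 0 *: E 0 in dE; set q := d 0 1 *: E 1 in dE.
have -> : dotmul (compass_difference f x) d =
    2^-1 * ((g (- q + d) - g (- q)) + (g (- p + d) - g (- p))).
  have -> : - q + d = p by rewrite dE addrC addrK.
  have -> : - p + d = q by rewrite dE addKr.
  rewrite /dotmul big_ord_recl big_ord1 !mxE.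
  rewrite (_ : lift ord0 ord0 = 1); last exact: val_inj.
  have := gE 0 (d 0 0); have := gE 1 (d 0 1); rewrite -/p -/q /E /g; lra.
have := He (- q); have := He (- p).
case: e He => [r||] _; rewrite ?leey// !lee_fin; lra.
Qed.

(* [free [:: w; d]] makes [w, d] admissible lexicographic directions, and for the
   resulting lexicographic subgradient [s], homogeneity gives
   <s, d> = f^(2)(d) = f^(1)(d) = [f'(x; .)]'(w; d). *)
Lemma dir_derive2_le f x w d (c : R) : L_smooth f x -> free [:: w; d] ->
  (forall s, lex_subdifferential f x s -> dotmul s d <= c) ->
  dir_derive (dir_derive f x) w d <= c.
Proof.
move=> fx wd Hc; have [df dlex] := fx.
pose m := [tuple w; d].
have [s sm] := lex_derive_dotmul fx (wd : free m).
apply: le_trans (Hc s _); last by exists m.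
rewrite -sm.
have -> : lex_derive f x m 2 d = lex_derive f x m 1 d.
  apply: (dir_derive_additive_self _ _).1; last exact: (dlex m 1%N).
  exact: (@lex_derive_poshom _ _ f x m 1).
exact: lexx.
Qed.

Lemma exists_notin_vline d : exists v, v \notin <[d]>%VS.
Proof.
apply: contrapT => /forallNP dv.
have /dimvS : (fullv <= <[d]>)%VS by apply/subvP => v _; exact/negbNE/negP.
by rewrite dimvf dim_matrix dim_vline; case: eqP.
Qed.

(* Along the line [u + t d] the mean value inequality applies as long as the line
   avoids the origin; the remaining [u] are limits of such ones. *)
Lemma dir_derive_increment_le f x d (c : R) : L_smooth f x ->
  continuous (dir_derive f x) -> d != 0 ->
  (forall s, lex_subdifferential f x s -> dotmul s d <= c) ->
  forall u, dir_derive f x (u + d) - dir_derive f x u <= c.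
Proof.
move=> fx cg d0 Hc; have [df dlex] := fx; set g := dir_derive f x.
have gle u : u \notin <[d]>%VS -> g (u + d) - g u <= c.
  move=> ud; apply: dir_derive_le_increment => // t _; split.
    (* At index 0 only the first entry of the tuple matters. *)
    exact: (dlex [tuple u + t *: d; d] 0%N).
  apply: dir_derive2_le => //.
  rewrite free_cons span_seq1 seq1_free d0 andbT.
  by rewrite rpredDr// rpredZ ?memv_line.
move=> u; have [ud|] := boolP (u \in <[d]>%VS); last exact: gle.
have [v vd] := exists_notin_vline d.
have cu w : g (w + t *: v) @[t --> 0^'+] --> g w.
  exact: (cvg_comp _ _ (@cvg_ray _ _ w v) (cg w)).
apply: (cvgr_to_le (cvgB (cu (u + d)) (cu u))).
near=> t; have t0 : 0 < t by [].
have := gle (u + t *: v); rewrite addrAC; apply.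
by rewrite rpredDl// rpredZeq negb_or gt_eqF.
Unshelve. all: by end_near. Qed.

End plane.

Theorem theorem3p3 (R : realType) (X : set 'rV[R]_2) (f : 'rV[R]_2 -> R)
    (openX : open X) (lipf : [locally [lipschitz f y | y in X]]) :
  (forall x, x \in X -> dir_differentiable f x ->
     compass_difference f x \in clarke_gradient f x) /\
  (forall x, x \in X -> L_smooth f x ->
     compass_difference f x \in closure (convex_hull (lex_subdifferential f x)) /\
     closure (convex_hull (lex_subdifferential f x)) `<=` clarke_gradient f x).
Proof.
split=> [x _ df|x /[!inE] Xx fx].
  rewrite inE => d; apply: compass_difference_le => // u.
  have := slope_le_clarke d df u ltr01.
  by rewrite /diff_quotient scale1r divr1; exact.
have [df _] := fx.
have [M fM] := locally_lipschitz_near openX lipf Xx.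
have cg := lipschitz_continuous (dir_derive_lipschitz df fM).
set L := lex_subdifferential f x.
have convL : convex_set (convex_hull L).
  apply/convex_setP => u v a a01 Lu Lv B [Bconv LB].
  by apply: (convex_setP B).1 => //; [exact: Lu|exact: Lv].
split; last first.
  rewrite [X in _ `<=` X](closure_id _).1; last exact: clarke_gradient_closed.
  apply: closureS; apply: smallest_sub; first exact: clarke_gradient_convex.
  exact: lex_subdifferential_clarke.
apply: contrapT => pK.
have LK : L `<=` closure (convex_hull L).
  by apply: subset_trans (@subset_closure _ _); exact: sub_gen_smallest.
have K0 : closure (convex_hull L) !=set0.
  (* Any basis yields a lexicographic subgradient; one is completed from the all-ones vector. *)
  have [v v1] := exists_notin_vline (const_mx 1 : 'rV[R]_2).
  have free2 : free [tuple v; const_mx 1].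
    rewrite free_cons span_seq1 seq1_free v1; apply/eqP => /rowP/(_ 0).
    by rewrite !mxE => /eqP; rewrite oner_eq0.
  have [s sm] := lex_derive_dotmul fx free2.
  by exists s; apply: LK; exists [tuple v; const_mx 1].
have [d [c cp Kc]] := closed_convex_separation (@closed_closure _ _)
  (convex_closure convL) K0 pK.
(* For [d = 0] the separation would read [c < 0 <= c], the second part coming from a point of the
   closed hull. *)
have d0 : d != 0.
  apply/eqP => d0; have [s Ks] := K0; have := Kc s Ks.
  by move: cp; rewrite d0 !dotmul0r; lra.
have Lc s : L s -> dotmul s d <= c by move=> /LK; exact: Kc.
suff : ((dotmul (compass_difference f x) d)%:E <= c%:E)%E.
  by rewrite lee_fin leNgt cp.
apply: compass_difference_le => // u; rewrite lee_fin.
exact: dir_derive_increment_le.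
Qed.
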